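(* Fix $b>0$. For each integer $n\ge 1$ and each $c>0$, let $\varepsilon=b/n$ and consider the system of $n$ intervals $I^1_t,\dots,I^n_t$, $t\ge 0$, of length $\varepsilon$ (one-dimensional Brownian spheres pushed by a barrier of velocity $c$, as defined in the context), and suppose that the intervals $\{I^k\}$ have the pseudo-stationary distribution. For $0\le x<y<\infty$ let $$\mathbf{d}_t([x,y])=\frac{\lambda\left([x+ct,\,y+ct]\cap\bigcup_{1\le k\le n}I^k_t\right)}{y-x},$$ where $\lambda$ is Lebesgue measure. Fix arbitrary $p_1<1$, $d_1<1$, $d_2>0$, and $0\le x_1<x_2<b<x_3<x_4<\infty$. Then there exist $c_0,n_0<\infty$ such that for all $c\ge c_0$, all $n\ge n_0$ and all $t\ge 0$, $$P\left(\mathbf{d}_t([x_1,x_2])\ge d_1\right)\ge p_1\qquad\text{and}\qquad P\left(\mathbf{d}_t([x_3,x_4])\le d_2\right)\ge p_1.$$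
   Context: Definition of the model. Fix $b>0$, $c>0$, an integer $n\ge1$, and put $\varepsilon=b/n$. Informally: $n$ disjoint open intervals of length $\varepsilon$ on the line have centers driven by independent Brownian motions, reflect instantaneously when they collide, and the leftmost one reflects on the moving barrier $x=ct$. Formally, $X^0_t=-\varepsilon/2+ct$, $X^{n+1}\equiv\infty$, and $X^1,\dots,X^n$ are continuous processes with $X^k_t-X^{k-1}_t\ge\varepsilon$ for all $1\le k\le n$, $t\ge0$, and $dX^k_t=dB^k_t+dL^k_t-dM^k_t$, where $B^1,\dots,B^n$ are i.i.d. standard Brownian motions and $L^k,M^k$ are nondecreasing processes such that $\int_0^\infty 1_{\{X^k_t-X^{k-1}_t>\varepsilon\}}\,dL^k_t=0$ and $\int_0^\infty 1_{\{X^{k+1}_t-X^k_t>\varepsilon\}}\,dM^k_t=0$. The solution is constructed as follows. Let $Z^1,\dots,Z^n$ be $[0,\infty)$-valued processes with $dZ^k_t=dB^k_t-c\,dt$, reflected at $0$, where the $B^k$ are independent standard Brownian motions. For each $t\ge0$ let $Y^1_t\le Y^2_t\le\dots\le Y^n_t$ be the values $Z^1_t,\dots,Z^n_t$ arranged in nondecreasing order. Set $$X^k_t=Y^k_t+(k-1)\varepsilon+\varepsilon/2+ct,\qquad I^k_t=(X^k_t-\varepsilon/2,\;X^k_t+\varepsilon/2),\qquad 1\le k\le n.$$ Pseudo-stationary distribution. Each process $Z^k$ (Brownian motion with drift $-c$ reflected at $0$) has a stationary distribution, with density $2c\,e^{-2cz}$, $z\ge0$. The intervals $\{I^k\}$ are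 said to have the pseudo-stationary distribution if $Z^1_t,\dots,Z^n_t$ are independent and each has this stationary distribution for $t=0$ (and therefore for every $t\ge0$). *)

(* Defs.v *)
From HB Require Import structures.
From mathcomp Require Import all_boot all_order all_algebra.
From mathcomp Require Import all_classical all_reals all_analysis.
Import Order.TTheory GRing.Theory Num.Theory.
Import numFieldNormedType.Exports.

Set Implicit Arguments.
Unset Strict Implicit.
Unset Printing Implicit Defensive.

Local Open Scope classical_set_scope.
Local Open Scope ring_scope.

Definition mutually_independent (disp : measure_display)
    (T : measurableType disp) (R : realType) (P : probability T R)
    (I : finType) (F : I -> set (set T)) : Prop :=
  forall (J : {set I}) (A : I -> set T),
    (forall i, i \in J -> F i (A i)) ->
    P (\bigcap_(i in [set` J]) A i) = (\prod_(i in J) P (A i))%E.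

Definition sigma_rv (disp : measure_display) (T : measurableType disp)
    (R : realType) (X : T -> R) : set (set T) :=
  preimage_set_system [set: T] X measurable.

Definition sigma_family (disp : measure_display) (T : measurableType disp)
    (R : realType) (I : Type) (D : set I) (X : I -> T -> R) : set (set T) :=
  <<s \bigcup_(i in D) sigma_rv (X i) >>.

(* Processes are indexed by all of R; only times t >= 0 are constrained.
   Laws are compared on measurable sets only, since normal_prob and
   exponential_prob are meaningless on the others. *)
Definition brownian_motion (disp : measure_display) (T : measurableType disp)
    (R : realType) (P : probability T R) (B : R -> {RV P >-> R}) : Prop :=
  [/\ {ae P, forall w, B 0 w = 0},
      forall s t : R, 0 <= s -> s < t -> forall A : set R, measurable A ->
        P ((fun w => B t w - B s w) @^-1` A)
        = normal_prob 0 (Num.sqrt (t - s)) A,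
      forall (m : nat) (t : nat -> R), 0 <= t 0%N ->
        (forall i, t i <= t i.+1) ->
        mutually_independent P
          (fun i : 'I_m => sigma_rv (fun w => B (t i.+1) w - B (t i) w))
    & {ae P, forall w,
        {within `[0, +oo[, continuous (fun t : R => B t w)}} ].

(* z is the path w reflected at 0 (Skorokhod problem): z = w + l >= 0 where
   the nondecreasing l starts from 0 and increases only when z = 0.  Having l
   vanish for t < 0 excludes an atom of dl at time 0. *)
Definition reflected_at_0 (R : realType) (w z : R -> R) : Prop :=
  {within `[0, +oo[, continuous z} /\
  exists l : cumulative R R,
    [/\ forall t : R, t <= 0 -> l t = 0,
        forall t : R, 0 <= t -> 0 <= z t,
        forall t : R, 0 <= t -> z t = w t + l t
      & (\int[lebesgue_stieltjes_measure l]_(t in `[0%R, +oo[)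
           (\1_[set s : R | 0 < z s] t)%:E = 0)%E ].

(* The driving Brownian motions are independent of each other and of the
   initial positions (index None); no joint law is imposed on the latter. *)
Definition reflected_drifted_bms (disp : measure_display)
    (T : measurableType disp) (R : realType) (P : probability T R) (c : R)
    (n : nat) (B Z : 'I_n -> R -> {RV P >-> R}) : Prop :=
  [/\ forall k, brownian_motion (B k),
      mutually_independent P (fun o : option 'I_n =>
        if o is Some k
        then sigma_family `[0%R, +oo[ (fun t : R => B k t : T -> R)
        else sigma_family [set: 'I_n] (fun k => Z k 0 : T -> R))
    & forall k, {ae P, forall w,
        reflected_at_0 (fun t => Z k 0 w + B k t w - c * t)
                       (fun t => Z k t w)} ].

(* exponential_prob (2 * c) has density 2c exp(-2cz) on [0, +oo[. *)
Definition pseudo_stationary (disp : measure_display)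
    (T : measurableType disp) (R : realType) (P : probability T R) (c : R)
    (n : nat) (Z : 'I_n -> R -> {RV P >-> R}) : Prop :=
  mutually_independent P (fun k : 'I_n => sigma_rv (Z k 0)) /\
  forall (k : 'I_n) (A : set R), measurable A ->
    P (Z k 0 @^-1` A) = exponential_prob (2 * c) A.

(* The index k : 'I_n is 0-based: k here is k + 1 in the usual numbering. *)
Definition order_statistic (R : realType) (n : nat) (z : 'I_n -> R)
    (k : 'I_n) : R :=
  nth 0 (sort <=%R (codom z)) k.

Definition sphere_center (R : realType) (eps c : R) (n : nat)
    (z : 'I_n -> R) (t : R) (k : 'I_n) : R :=
  order_statistic z k + k%:R * eps + eps / 2 + c * t.

Definition sphere (R : realType) (eps c : R) (n : nat)
    (z : 'I_n -> R) (t : R) (k : 'I_n) : set R :=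
  `]sphere_center eps c z t k - eps / 2, sphere_center eps c z t k + eps / 2[.

Definition density (R : realType) (eps c : R) (n : nat)
    (z : 'I_n -> R) (t x y : R) : \bar R :=
  (lebesgue_measure (`[(x + c * t)%R, (y + c * t)%R]
                       `&` \bigcup_(k : 'I_n) sphere eps c z t k)
   * ((y - x)^-1)%:E)%E.

(* Main.v *)
(** No exact stationarity and no independence between the [Z k] at time [t] is
    needed.  From Skorokhod's equation, looking back to the last zero of the
    reflected path before [t], one gets
      [Z k t <= Z k 0 + sup_(s <= t) (B k t - B k s - c (t - s))].
    On a regular time grid the supremum is a Lindley recursion
      [V (i+1) = max 0 (V i + X i - c h)]
    driven by independent centred Gaussian steps of variance [h]; since
    [exp (2 c (X i - c h))] has mean 1, induction gives
    [P (V i > y) <= exp (- 2 c y)], uniformly in the grid and in the horizon.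
    With the exponential tail of [Z k 0],
      [P (Z k t > d) <= 2 exp (- c d)]  for all [t].
    By Markov's inequality, outside an event of small probability at most
    [eta n] of the [Z k t] exceed [d].  Then, in the frame of the barrier, all but
    [eta n] spheres lie in [[0, b + d]] and the gaps below them have total length
    at most [d]; both density bounds follow. *)

Require Import Defs.
From HB Require Import structures.
From mathcomp Require Import all_boot all_order all_algebra.
From mathcomp Require Import all_classical all_reals all_analysis.
From mathcomp Require Import measurable_realfun normal_distribution.
From mathcomp Require Import exponential_distribution.
From mathcomp Require Import ring lra.
Import Order.TTheory GRing.Theory Num.Theory.
Import numFieldNormedType.Exports.

Set Implicit Arguments.
Unset Strict Implicit.
Unset Printing Implicit Defensive.

Local Open Scope classical_set_scope.
Local Open Scope ring_scope.

(** * Almost sure comparison, Gaussian integrals, laws of independent pairs *)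

Lemma measurable_set_gt (disp : measure_display) (T : measurableType disp)
    (R : realType) (f : T -> R) (y : R) :
  measurable_fun [set: T] f -> measurable [set w | y < f w].
Proof.
move=> mf; rewrite (_ : [set _ | _] = f @^-1` `]y, +oo[).
  by rewrite -[X in measurable X]setTI; exact: mf.
by apply/seteqP; split => x /=; rewrite in_itv/= andbT.
Qed.

Lemma measurable_set_le (disp : measure_display) (T : measurableType disp)
    (R : realType) (f : T -> R) (y : R) :
  measurable_fun [set: T] f -> measurable [set w | f w <= y].
Proof.
move=> mf; rewrite (_ : [set _ | _] = ~` [set w | y < f w]).
  by apply: measurableC; exact: measurable_set_gt.
by apply/seteqP; split => w /=; rewrite leNgt => /negP.
Qed.

(** The null exceptional set is added to [A']. This form is needed because reflection and path
    continuity hold only almost surely. *)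
Lemma le_measure_ae (disp : measure_display) (T : measurableType disp)
    (R : realType) (mu : {measure set T -> \bar R}) (A A' : set T) :
  measurable A -> measurable A' -> {ae mu, forall w, A w -> A' w} ->
  (mu A <= mu A')%E.
Proof.
move=> mA mA' [N [mN N0 AN]].
apply: (@le_trans _ _ (mu (A' `|` N))).
  apply: le_measure; rewrite ?inE//; first exact: measurableU.
  move=> w Aw; have [A'w|A'w] := pselect (A' w); [by left|right].
  by apply: AN => /(_ Aw).
by rewrite (le_trans (measureU2 _ mA' mN))// [X in (_ + X)%E]N0 adde0.
Qed.

(** The Radon-Nikodym derivative and [normal_pdf] have the same integral over every measurable set,
    hence agree almost everywhere. *)
Lemma ge0_integral_normal_prob (R : realType) (m s : R) (f : R -> \bar R) :
  measurable_fun [set: R] f -> (forall x, 0 <= f x)%E ->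
  (\int[normal_prob m s]_x f x =
   \int[lebesgue_measure]_x (f x * (normal_pdf m s x)%:E))%E.
Proof.
move=> mf f0; have dom := @normal_prob_dominates R m s.
rewrite -(Radon_Nikodym_SigmaFinite.change_of_variables dom)//.
have iRN := Radon_Nikodym_SigmaFinite.f_integrable dom.
have mpdf : measurable_fun [set: R] (EFin \o normal_pdf m s).
  by apply/measurable_EFinP; exact: measurable_normal_pdf.
apply: ae_eq_integral => //.
- by apply: emeasurable_funM => //; exact: measurable_int iRN.
- exact: emeasurable_funM.
- apply: ae_eqe_mul2l; apply: integral_ae_eq => // E _ mE.
  by rewrite -Radon_Nikodym_SigmaFinite.f_integral.
Qed.

(** Completing the square: tilting by [expR (a * x)] moves the mean to [a * s ^+ 2], up to the
    constant on the right. *)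
Lemma normal_prob_expR (R : realType) (s a : R) : s != 0 ->
  (\int[normal_prob 0 s]_x (expR (a * x))%:E = (expR (a ^+ 2 * s ^+ 2 / 2))%:E)%E.
Proof.
move=> s0; rewrite ge0_integral_normal_prob; last 2 first.
- by apply/measurable_EFinP; apply: measurableT_comp => //; exact: measurable_funM.
- by move=> x; rewrite lee_fin expR_ge0.
transitivity (\int[@lebesgue_measure R]_x
    ((expR (a ^+ 2 * s ^+ 2 / 2))%:E * (normal_pdf (a * s ^+ 2) s x)%:E))%E;
  last first.
  rewrite ge0_integralZl//= ?integral_normal_pdf ?mule1//.
  - by apply/measurable_EFinP; exact: measurable_normal_pdf.
  - by move=> x _; rewrite lee_fin normal_pdf_ge0.
apply: eq_integral => x _; rewrite -!EFinM !normal_pdfE// mulrCA [in RHS]mulrCA.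
congr (_ * _)%:E; rewrite /normal_fun -!expRD; congr expR.
by rewrite subr0 -mulr_natr; field; rewrite s0.
Qed.

Lemma ge0_integral_normal_distribution (disp : measure_display)
    (T : measurableType disp) (R : realType) (P : probability T R)
    (X : {RV P >-> R}) (m s : R) (f : R -> \bar R) :
  (forall A, measurable A -> P (X @^-1` A) = normal_prob m s A) ->
  measurable_fun [set: R] f -> (forall x, 0 <= f x)%E ->
  (\int[distribution P X]_x f x = \int[normal_prob m s]_x f x)%E.
Proof.
move=> XE mf f0.
rewrite ge0_integral_distribution//.
have mX : measurable_fun [set: T] (X : T -> R) by exact: measurable_funP.
have mX' : measurable_fun [set: T] (X : T -> measurableTypeR R).
  move=> mT A mA; exact: (mX mT A mA).
have := @ge0_integral_pushforward _ _ T (measurableTypeR R) R X mX' P setT f.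
rewrite preimage_setT => <-//.
by apply: eq_measure_integral => A mA _; exact: XE.
Qed.
(** Two finite measures that agree on the pi-system of rectangles are equal. The extra event [E]
    enters only as a scalar factor. *)
Lemma indep_pairE (disp : measure_display) (T : measurableType disp)
    (R : realType) (P : probability T R) (X Y : {RV P >-> R}) (E : set T) :
  measurable E ->
  (forall A B : set R, measurable A -> measurable B ->
    P (X @^-1` A `&` Y @^-1` B `&` E)
    = (P (X @^-1` A) * P (Y @^-1` B) * P E)%E) ->
  forall C : set (R * R), measurable C ->
    P ((fun w => (X w, Y w)) @^-1` C `&` E)
    = ((distribution P X \x^ distribution P Y) C * P E)%E.
Proof.
move=> mE XYE C mC.
have mXY : measurable_fun [set: T] (fun w => (X w, Y w)).
  exact: measurable_fun_pair.
have PE0 : 0 <= fine (P E) by rewrite fine_ge0.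
pose m1 : {measure set (R * R) -> \bar R} :=
  pushforward (mrestr P mE) (fun w => (X w, Y w)).
pose m2 : {measure set (R * R) -> \bar R} :=
  mscale (NngNum PE0) (distribution P X \x^ distribution P Y)%E.
pose G := [set A `*` B | A in @measurable _ R & B in @measurable _ R].
rewrite muleC -[P E]fineK ?fin_num_measure//.
suff : m1 mXY C = m2 C by [].
apply: (measure_unique G (fun=> setT)) => //.
- rewrite measurable_prod_measurableType; congr (<<s _ >>).
- move=> _ _ [A mA [B mB <-]] [A' mA' [B' mB' <-]]; rewrite -setXI.
  exists (A `&` A'); first exact: measurableI.
  by exists (B `&` B') => //; exact: measurableI.
- by move=> _; exists setT => //; exists setT => //; rewrite setXTT.
- by rewrite bigcup_const//; exists 0%N.
- move=> _ [A mA [B mB <-]]; transitivity (P (X @^-1` A `&` Y @^-1` B `&` E)) => //.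
  rewrite XYE// /m2/= /mscale/= product_measure2E// fineK ?fin_num_measure//.
  by rewrite muleC.
- move=> _; rewrite /m1/= /pushforward /mrestr/= preimage_setT setTI.
  by rewrite -ge0_fin_numE// fin_num_measure.
Qed.

(** * Pathwise consequences of the Skorokhod problem *)

Lemma lebesgue_stieltjes_itvoc (R : realType) (l : cumulative R R) (a b : R) :
  a <= b -> lebesgue_stieltjes_measure l `]a, b] = (l b - l a)%:E.
Proof.
move=> ab; rewrite /lebesgue_stieltjes_measure /measure_extension/=.
by rewrite measurable_mu_extE/= ?wlength_itv_bnd//; exact: is_ocitv.
Qed.

(** The measure [dl] gives no mass to times where [z > 0], and []u, t]] consists of such times. *)
Lemma reflected_flat (R : realType) (z : R -> R) (l : cumulative R R) (u t : R) :
  0 <= u -> u <= t -> {within `[0, +oo[, continuous z} ->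
  (\int[lebesgue_stieltjes_measure l]_(t in `[0%R, +oo[)
     (\1_[set s : R | 0 < z s] t)%:E = 0)%E ->
  (forall s, u < s -> s <= t -> 0 < z s) -> l t = l u.
Proof.
move=> u0 ut cz l0 zpos.
pose A := `[0, +oo[ `&` z @^-1` `]0, +oo[.
have mA : measurable A.
  exact: (subspace_continuous_measurable_fun _ cz).
have utA : `]u, t] `<=` A.
  move=> s /=; rewrite in_itv/= => /andP[us st].
  rewrite /A/= !in_itv/= !andbT (le_trans u0 (ltW us)); split => //.
  exact: zpos.
have : (lebesgue_stieltjes_measure l `]u, t] <= 0)%E.
  rewrite -l0 (_ : (\int[_]_(_ in _) _)%E =
      (\int[lebesgue_stieltjes_measure l]_(t in `[0%R, +oo[) (\1_A t)%:E)%E).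
    rewrite integral_indic// le_measure ?inE//; first exact: measurableI.
    by move=> s uts; split; [exact: utA|have [] := utA _ uts].
  apply: eq_integral => s; rewrite inE => s0.
  rewrite !indicE /A in_setI (mem_set s0)/=; congr (_%:R)%:E; congr nat_of_bool.
  by apply/idP/idP; rewrite !inE/= in_itv/= andbT.
rewrite lebesgue_stieltjes_itvoc// lee_fin subr_le0 => lut.
by apply/eqP; rewrite eq_le lut/=; exact: cumulative_is_nondecreasing.
Qed.

(** Take for [s] the last zero of [z] before [t], or 0 if there is none: [l] is flat on [[s, t]], so
    [z] and [w] have the same increment there, and [z s <= z 0]. *)
Lemma reflected_le (R : realType) (w z : R -> R) (t : R) :
  reflected_at_0 w z -> 0 <= t ->
  exists s, [/\ 0 <= s, s <= t & z t <= z 0 + (w t - w s)].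
Proof.
move=> [cz [l [l0 z0 zE li]]] t0.
have [zt0|zt0] := eqVneq (z t) 0.
  by exists t; rewrite subrr addr0 zt0; split => //; exact: z0.
(* Time 0 is put in [S] by hand, so that [S] is nonempty even when [z] has no zero on [[0, t]]. *)
pose S := [set s | [/\ 0 <= s, s <= t & s = 0 \/ z s = 0]].
have S0 : S 0 by split => //; left.
have tS : ubound S t by move=> s [].
have hS : has_sup S by split; [exists 0|exists t].
have u0 : 0 <= sup S by apply: ub_le_sup => //; exists t.
have ut : sup S <= t by apply: ge_sup => //; exists 0.
exists (sup S); split => //.
have zpos s : sup S < s -> s <= t -> 0 < z s.
  move=> us st; have s0 : 0 <= s by rewrite (le_trans u0)// ltW.
  rewrite lt_neqAle z0// andbT eq_sym; apply/negP => /eqP zs0.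
  have : s <= sup S by apply: ub_le_sup => //; [exists t|split => //; right].
  by rewrite leNgt us.
have lE := reflected_flat u0 ut cz li zpos.
rewrite zE//; have := zE _ u0; rewrite -lE => zu.
suff : z (sup S) <= z 0 by lra.
have [->//|uN0] := eqVneq (sup S) 0.
suff -> : z (sup S) = 0 by exact: z0.
have {}u0 : 0 < sup S by rewrite lt_neqAle eq_sym uN0.
(* If [z] were positive at [sup S], it would be so nearby by continuity; but [S] has points
   arbitrarily close to [sup S > 0], and the positive ones are zeros of [z]. *)
apply/eqP; apply: contrapT => /negP zu0.
have {}zu0 : 0 < z (sup S) by rewrite lt_neqAle eq_sym zu0 z0// ltW.
have /continuous_within_itvcyP[czi _] := cz.
have /(_ _)/cvgr_gt/(_ _ zu0) := czi (sup S).
rewrite in_itv/= u0 => /(_ isT) /nbhs_ballP[e /= e0 ze].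
have m0 : 0 < Num.min e (sup S) by rewrite lt_min e0.
have [s Ss] := sup_adherent m0 hS.
rewrite ltrBlDr -ltrBlDl lt_min => /andP[se su].
have sS : s <= sup S by apply: ub_le_sup => //; exists t.
have s0 : 0 < s by move: su; rewrite ltrBlDr ltrDl.
have : 0 < z s by apply: ze; rewrite /ball/= ger0_norm ?subr_ge0.
by case: Ss => _ _ [s00|->]; [move: s0; rewrite s00 ltxx|rewrite ltxx].
Qed.

(** * The Lindley recursion with Gaussian steps *)

Section lindley.
Context (disp : measure_display) (T : measurableType disp) (R : realType)
  (P : probability T R).
Context (b : R) (D : nat -> {RV P >-> R}).

(** Unrolled, this is the maximum over [i <= n] of the sums of [x k - b] for [i <= k < n]; [b] is
    the drift per step. *)
Fixpoint lindley (x : nat -> R) (n : nat) : R :=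
  if n is m.+1 then Num.max 0 (lindley x m + x m - b) else 0.

Definition lindley_rv (n : nat) (w : T) : R := lindley (fun i => D i w) n.

Lemma measurable_lindley_rv n : measurable_fun [set: T] (lindley_rv n).
Proof.
elim: n => [|n ih]; first exact: measurable_cst.
apply: measurable_maxr; first exact: measurable_cst.
by apply: measurable_funB => //; exact: measurable_funD.
Qed.

HB.instance Definition _ n :=
  isMeasurableFun.Build _ _ _ _ (lindley_rv n) (measurable_lindley_rv n).

Context (N : nat).

(** Only finite intersections of single-step events, not the generated sigma-algebra: the product
    rule of [mutually_independent] applies to them directly. *)
Definition future (j : nat) : set (set T) :=
  [set E | exists (J : {set 'I_N}) (A : 'I_N -> set T),
    (forall i, i \in J -> (j <= i)%N /\ sigma_rv (D i) (A i)) /\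
    E = \bigcap_(i in [set` J]) A i].

Lemma future_measurable j E : future j E -> measurable E.
Proof.
move=> [J [A [AJ ->]]]; apply: fin_bigcap_measurable => // i iJ.
have [_ [B mB <-]] := AJ _ iJ; rewrite setTI.
by rewrite -[X in measurable X]setTI; exact: measurable_funP.
Qed.

Lemma future_setT j : future j [set: T].
Proof.
exists finset.set0, (fun=> setT); split; first by move=> i; rewrite finset.in_set0.
by rewrite bigcapT.
Qed.

Context (indD : mutually_independent P (fun i : 'I_N => sigma_rv (D i))).

(** All indices used by [E] exceed [j], so [j] is new to [J] and the product rule splits off its
    factor. *)
Lemma future_cons j E B : (j < N)%N -> measurable B -> future j.+1 E ->
  future j (D j @^-1` B `&` E) /\
  P (D j @^-1` B `&` E) = (P (D j @^-1` B) * P E)%E.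
Proof.
move=> jN mB [J [A [AJ ->]]]; pose j' := Ordinal jN.
pose A' i := if i == j' then D j @^-1` B else A i.
have jJ : j' \notin J by apply/negP => /AJ[]; rewrite ltnn.
have A'E i : i \in J -> A' i = A i.
  by rewrite /A'; case: eqP => // -> jJ'; rewrite jJ' in jJ.
have EE : D j @^-1` B `&` \bigcap_(i in [set` J]) A i =
    \bigcap_(i in [set` (j' |: J)%SET]) A' i.
  apply/seteqP; split => [w [Bw Aw] i /=|w Aw].
    rewrite finset.in_setU1 => /predU1P[->|iJ]; first by rewrite /A' eqxx.
    by rewrite A'E//; exact: Aw.
  split; first by have := Aw j'; rewrite /A' eqxx; apply; rewrite /= finset.setU11.
  by move=> i iJ; rewrite -A'E//; apply: Aw; rewrite /= finset.in_setU1 iJ orbT.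
have sA' i : i \in (j' |: J)%SET -> (j <= i)%N /\ sigma_rv (D i) (A' i).
  rewrite finset.in_setU1 => /predU1P[->|iJ]; last first.
    by rewrite A'E//; have [/ltnW ji ?] := AJ _ iJ.
  by split=> //; rewrite /A' eqxx; exists B => //; rewrite setTI.
split; first by rewrite EE; exists (j' |: J)%SET, A'.
rewrite EE indD; last by move=> i /sA'[].
rewrite finset.big_setU1//= {1}/A' eqxx; congr (_ * _)%E.
rewrite indD; last by move=> i /AJ[].
by apply: eq_bigr => i iJ; rewrite A'E.
Qed.

(* Carrying a future event [E] through the induction replaces a statement on the
   sigma-algebra generated by the first [j] steps: [D j] is pushed into [E]. *)
Lemma lindley_indep j E A : (j <= N)%N -> measurable A -> future j E ->
  P (lindley_rv j @^-1` A `&` E) = (P (lindley_rv j @^-1` A) * P E)%E.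
Proof.
elim: j E A => [|j ih] E A jN mA fE.
  have [A0|A0] := pselect (A 0).
    by rewrite (_ : _ @^-1` A = setT) ?setTI ?probability_setT ?mul1e// -subTset.
  rewrite (_ : _ @^-1` A = set0) ?set0I ?measure0 ?mul0e//.
  by rewrite -subset0.
pose C := [set x : R * R | A (Num.max 0 (x.1 + x.2 - b))].
have mC : measurable C.
  rewrite -[C]setTI.
  apply: (_ : measurable_fun setT
    (fun x : R * R => Num.max 0 (x.1 + x.2 - b))) => //.
  apply: measurable_maxr; first exact: measurable_cst.
  by apply: measurable_funB => //; exact: measurable_funD.
have key F : future j.+1 F -> P (lindley_rv j.+1 @^-1` A `&` F) =
    ((distribution P (lindley_rv j) \x^ distribution P (D j)) C * P F)%E.
  move=> fF; rewrite -indep_pairE//; first exact: future_measurable fF.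
  move=> A1 B1 mA1 mB1; rewrite -setIA.
  have [f1 f2] := future_cons jN mB1 fF.
  by rewrite ih//; [rewrite f2 muleA|exact: ltnW].
(* With [F = setT] the same formula identifies the product measure of [C] as the probability that
   [lindley_rv j.+1] lies in [A]. *)
rewrite key//; have := key _ (future_setT j.+1).
by rewrite setIT probability_setT mule1 => ->.
Qed.

(* [a * s ^+ 2 = 2 * b] says that [expR (a * (D i - b))] has expectation 1. *)
Lemma lindley_tail (s a : R) : s != 0 -> 0 <= a -> a * s ^+ 2 = 2 * b ->
  (forall i A, (i < N)%N -> measurable A -> P (D i @^-1` A) = normal_prob 0 s A) ->
  forall j y, (j <= N)%N ->
  (P [set w | (y < lindley_rv j w)%R] <= (expR (- (a * y)))%:E)%E.
Proof.
move=> s0 a0 abs nD.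
(* The induction below evaluates the tail at [y + b - x], which may be negative; there the bound is
   at least 1. *)
have neg j y : y < 0 ->
    (P [set w | (y < lindley_rv j w)%R] <= (expR (- (a * y)))%:E)%E.
  move=> y0; apply: (@le_trans _ _ 1%E).
    apply: probability_le1; apply: measurable_set_gt.
    exact: measurable_lindley_rv.
  by rewrite lee_fin -expR0 ler_expR oppr_ge0 mulr_ge0_le0// ltW.
elim => [|j ih] y jN; have /orP[/neg//|y0] : (y < 0) || (0 <= y) by case: ltP.
  rewrite (_ : [set _ | _] = set0) ?measure0 ?lee_fin ?expR_ge0//.
  by rewrite -subset0 => w; rewrite /lindley_rv/= ltNge y0.
pose C := [set x : R * R | y + b < x.1 + x.2].
have mC : measurable C.
  by apply: measurable_set_gt; exact: measurable_funD.
have -> : [set w | y < lindley_rv j.+1 w] =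
    (fun w => (lindley_rv j w, D j w)) @^-1` C `&` setT.
  rewrite setIT; apply/seteqP.
  by split => w; rewrite /C /lindley_rv/= lt_max ltNge y0/= ltrBrDr.
rewrite indep_pairE//; last first.
  move=> A1 B1 mA1 mB1; rewrite -setIA.
  have [f1 f2] := future_cons jN mB1 (future_setT _).
  by rewrite lindley_indep ?f2 ?muleA//; exact: ltnW.
rewrite probability_setT mule1 /product_measure2.
have mexp : measurable_fun [set: R] (fun x => (expR (a * x))%:E).
  by apply/measurable_EFinP; apply: measurableT_comp => //; exact: measurable_funM.
(* Given [D j = x], the event says that [lindley_rv j] exceeds [y + b - x], and [ih] bounds its
   probability. *)
apply: (@le_trans _ _ (\int[distribution P (D j)]_x
    ((expR (- (a * (y + b))))%:E * (expR (a * x))%:E))%E).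
  apply: ge0_le_integral => //.
  - exact: measurable_fun_ysection.
  - exact: emeasurable_funM.
  move=> x _ /=; rewrite -EFinM -expRD.
  rewrite (_ : _ + _ = - (a * (y + b - x))); last by ring.
  rewrite (_ : distribution _ _ _ = P [set w | y + b - x < lindley_rv j w]).
    exact/ih/ltnW.
  by congr (P _); apply/seteqP; split => w; rewrite /ysection/= inE/= ltrBlDr.
rewrite ge0_integralZl//.
- rewrite (ge0_integral_normal_distribution (m := 0) (s := s))//.
    rewrite normal_prob_expR// -EFinM -expRD lee_fin ler_expR.
    rewrite (_ : a ^+ 2 * s ^+ 2 / 2 = a * b); first by lra.
    by rewrite (_ : a ^+ 2 * _ = a * (a * s ^+ 2)); [rewrite abs; field|ring].
  by move=> A mA; exact: nD.
Qed.
End lindley.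

(** * Supremum of Brownian motion with negative drift *)

(** At index [i] the recursion is nonnegative; from there to [j] keep the second branch of each
    maximum, so the increments of [f] telescope. *)
Lemma lindley_ge (R : realType) (b : R) (f : nat -> R) (i j : nat) :
  (i <= j)%N ->
  f j - f i - b * (j%:R - i%:R) <= lindley b (fun k => f k.+1 - f k) j.
Proof.
elim: j => [|j ih].
  by rewrite leqn0 => /eqP ->; rewrite !subrr mulr0 subr0.
rewrite leq_eqVlt => /predU1P[->|].
  by rewrite !subrr mulr0 subr0 /= le_max lexx.
rewrite ltnS => /ih {}ih; rewrite /= le_max; apply/orP; right.
by rewrite -natr1; lra.
Qed.

Lemma brownian_grid_tail (disp : measure_display) (T : measurableType disp)
    (R : realType) (P : probability T R) (B : R -> {RV P >-> R}) (c t y : R)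
    (N : nat) :
  brownian_motion B -> 0 < c -> 0 < t -> (0 < N)%N ->
  (P [set w | exists i : nat, (i <= N)%N /\
       (y < B t w - B (t * i%:R / N%:R) w - c * (t - t * i%:R / N%:R))%R]
   <= (expR (- (2 * c * y)))%:E)%E.
Proof.
move=> [_ nB iB _] c0 t0 N0; have NR0 : 0 < N%:R :> R by rewrite ltr0n.
pose g i := t * i%:R / N%:R.
have g0 i : 0 <= g i by rewrite divr_ge0// mulr_ge0// ltW.
have gS i : g i.+1 - g i = t / N%:R by rewrite /g -natr1; field; rewrite gt_eqF.
have tN0 : 0 < t / N%:R by rewrite divr_gt0.
have gN : g N = t by rewrite /g mulfK// gt_eqF.
pose D i : {RV P >-> R} := B (g i.+1) - B (g i).
pose b := c * (t / N%:R).
have indD : mutually_independent P (fun i : 'I_N => sigma_rv (D i)).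
  apply: iB; first exact: g0.
  by move=> i; rewrite -subr_ge0 gS ltW.
apply: (@le_trans _ _ (P [set w | (y < lindley_rv b D N w)%R])); last first.
  (* Here [a = 2 * c]: the step variance is [t / N] and the drift per step [c * (t / N)], so
     [a * s ^+ 2 = 2 * b] for every [N]. *)
  apply: (lindley_tail indD (s := Num.sqrt (t / N%:R))) => //.
  - by rewrite gt_eqF// sqrtr_gt0.
  - by rewrite mulr_ge0// ltW.
  - by rewrite sqr_sqrtr; [rewrite /b; ring|exact: ltW].
  - by move=> i A iN mA; rewrite -(gS i) -[RHS]nB//; rewrite -subr_gt0 gS.
apply: le_measure; rewrite ?inE.
- rewrite (_ : [set _ | _] = \bigcup_(i in `I_N.+1)
    [set w | y < B t w - B (g i) w - c * (t - g i)]); last first.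
    by apply/seteqP; split => w [i]; rewrite ?ltnS => -[]; exists i.
  apply: bigcup_measurable => i _; apply: measurable_set_gt.
  by apply: measurable_funB => //; exact: measurable_funB.
- by apply: measurable_set_gt; exact: measurable_lindley_rv.
- move=> w [i [iN yi]]; apply: (lt_le_trans yi).
  have := lindley_ge b (fun k => B (g k) w) iN.
  rewrite gN; apply: le_trans; rewrite -/(g i).
  rewrite lerB// /b /g.
  rewrite le_eqVlt; apply/orP; left; apply/eqP; field; by rewrite gt_eqF.
Qed.

(** [F] is the union of the grid events over dyadic grids. These are nested, so the uniform grid
    bound passes to the limit; a strict excess at any [s] persists at a nearby grid point by
    continuity. *)
Lemma brownian_sup_tail (disp : measure_display) (T : measurableType disp)
    (R : realType) (P : probability T R) (B : R -> {RV P >-> R}) (c t y : R) :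
  brownian_motion B -> 0 < c -> 0 <= t -> 0 < y ->
  exists F : set T,
    [/\ measurable F, (P F <= (expR (- (2 * c * y)))%:E)%E &
     forall w s, {within `[0, +oo[, continuous (fun r : R => B r w)} ->
       0 <= s -> s <= t -> y < B t w - B s w - c * (t - s) -> F w].
Proof.
move=> bB c0; rewrite le_eqVlt => /predU1P[<- y0|t0 _].
  exists set0; split => //; first by rewrite measure0 lee_fin expR_ge0.
  move=> w s _ s0 s0'; have -> : s = 0 by apply/eqP; rewrite eq_le s0' s0.
  by rewrite !subrr mulr0 subr0 ltNge ltW.
pose g m i : R := t * i%:R / (2 ^ m)%:R.
pose A s := [set w | y < B t w - B s w - c * (t - s)].
pose E m := [set w | exists i : nat, (i <= 2 ^ m)%N /\ A (g m i) w].
have mE m : measurable (E m).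
  rewrite (_ : E m = \bigcup_(i in `I_(2 ^ m).+1) A (g m i)); last first.
    by apply/seteqP; split => w [i]; rewrite ?ltnS => -[]; exists i.
  apply: bigcup_measurable => i _; apply: measurable_set_gt.
  by apply: measurable_funB => //; exact: measurable_funB.
have mF : measurable (\bigcup_m E m) by exact: bigcupT_measurable.
exists (\bigcup_m E m); split => //.
  have ndE : nondecreasing_seq E.
    apply/nondecreasing_seqP => m; apply/subsetPset => w [i [im Ai]].
    exists (2 * i)%N; split; first by rewrite expnS leq_mul2l.
    rewrite (_ : g m.+1 (2 * i)%N = g m i)// /g expnS !natrM; field.
    by rewrite pnatr_eq0 -lt0n expn_gt0.
  have := @nondecreasing_cvg_mu _ _ _ P _ mE mF ndE.
  move=> /(cvg_lim (@ereal_hausdorff R)) <-; apply: lime_le.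
    apply/ereal_nondecreasing_is_cvgn => m n mn /=.
    by apply: le_measure; rewrite ?inE//; apply/subsetPset/ndE.
  by apply: nearW => m; apply: brownian_grid_tail => //; rewrite expn_gt0.
move=> w s cB s0 st ys.
have sA : s \in `[0, +oo[%classic by rewrite inE/= in_itv/= s0.
(* Half of the slack at [s]: one half pays for the change of [B] between [s] and the grid point, the
   other for the change of drift. *)
pose K := (B t w - B s w - c * (t - s) - y) / 2.
have K0 : 0 < K by rewrite /K; lra.
have : \forall r \near within `[0, +oo[ (nbhs s), B r w < B s w + K.
  rewrite nbhs_subspace_in; last by rewrite inE in sA.
  by apply: (cvgr_lt (B s w)); [exact: cB|lra].
move=> /nbhs_ballP[e' /= e'0 He].
pose e := Num.min e' (K / c).
have e0 : 0 < e by rewrite lt_min e'0 divr_gt0.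
(* Since [m < 2 ^ m], the mesh [t / 2 ^ m] is below [e]; [i] will be the rank of the last grid point
   not after [s]. *)
pose m := Num.truncn (t / e).
have m0 : 0 < (2 ^ m)%:R :> R by rewrite ltr0n expn_gt0.
have te : t < e * (2 ^ m)%:R.
  rewrite mulrC -ltr_pdivrMr// (lt_le_trans (truncnS_gt _))// ler_nat.
  exact: ltn_expl.
pose q := s * (2 ^ m)%:R / t.
have q0 : 0 <= q by rewrite divr_ge0 ?mulr_ge0// ltW.
have /andP[q1 q2] := truncn_itv q0.
set i := Num.truncn q in q1 q2.
have gis : g m i <= s.
  by rewrite /g ler_pdivrMr// mulrC -ler_pdivlMr.
have sgi : s < g m i + e.
  rewrite -(ltr_pM2r m0) mulrDl /g divfK ?gt_eqF//.
  apply: (@lt_trans _ _ (t * i.+1%:R)).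
    by rewrite [X in _ < X]mulrC -ltr_pdivrMr.
  by rewrite -natr1 mulrDr mulr1 ltrD2l.
exists m => //; exists i; split.
  rewrite -(ler_nat R) (le_trans q1)// /q ler_pdivrMr// mulrC.
  by rewrite ler_pM2l.
have := He (g m i); rewrite /ball/= ger0_norm ?subr_ge0// ltrBlDl.
have /andP[-> sgK] : (s < g m i + e') && (s < g m i + K / c).
  move: sgi; rewrite -!ltrBlDl lt_min => /andP[? ?]; exact/andP.
have gi0 : 0 <= g m i by rewrite /g divr_ge0// ?mulr_ge0// ltW.
rewrite in_itv/= gi0 => /(_ isT isT) Bgi; rewrite /A/=.
have csg : c * (s - g m i) < K by rewrite mulrC -ltr_pdivlMr// ltrBlDl.
rewrite /K in Bgi csg; lra.
Qed.

(** * Lengths inside a window, and order statistics *)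

(** For [x <= y], the projection onto [[x, y]]. *)
Definition clamp (R : realType) (x y r : R) : R := Num.min y (Num.max x r).

Lemma clampDr (R : realType) (x y r a : R) :
  clamp (x + a) (y + a) (r + a) = clamp x y r + a.
Proof. by rewrite /clamp addr_minl addr_maxl. Qed.

Lemma clamp_le (R : realType) (x y : R) : {homo clamp x y : p q / p <= q}.
Proof.
move=> p q pq; rewrite /clamp le_min !ge_min lexx/=; apply/orP; right.
by rewrite ge_max !le_max lexx pq orbT.
Qed.

Lemma clamp_lip (R : realType) (x y p q : R) : x <= y -> p <= q ->
  clamp x y q - clamp x y p <= q - p.
Proof.
move=> xy pq; rewrite /clamp.
have [?|?] := lerP x p; have [?|?] := lerP x q;
  by have [?|?] := lerP y p; have [?|?] := lerP y q; have [?|?] := lerP y x; lra.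
Qed.

(** The intersection lies between the open and the closed interval with the clamped endpoints. *)
Lemma lebesgue_measure_clamp (R : realType) (x y p q : R) : x <= y -> p <= q ->
  lebesgue_measure (`[x, y] `&` `]p, q[) = (clamp x y q - clamp x y p)%:E.
Proof.
move=> xy pq; have AB := clamp_le x y pq.
have mS : measurable (`[x, y]%classic `&` `]p, q[%classic : set R).
  by apply: measurableI; exact: measurable_itv.
apply/eqP; rewrite eq_le; apply/andP; split.
  apply: (@le_trans _ _ (lebesgue_measure `[clamp x y p, clamp x y q])).
    apply: le_measure; rewrite ?inE//.
    move=> r /=; rewrite !in_itv/= => -[/andP[xr ry] /andP[pr rq]].
    by rewrite /clamp ge_min ge_max le_min le_max xr ry (ltW pr) (ltW rq)/= !orbT.
  rewrite lebesgue_measure_itv/= lte_fin; case: ltP => // _.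
  by rewrite lee_fin subr_ge0.
apply: (@le_trans _ _ (lebesgue_measure `]clamp x y p, clamp x y q[)).
  rewrite lebesgue_measure_itv/= lte_fin; case: ltP => [//|BA].
  by rewrite lee_fin subr_le0.
apply: le_measure; rewrite ?inE//.
move=> r /=; rewrite !in_itv/= /clamp gt_min lt_min gt_max lt_max.
move=> /andP[rA /andP[ry rB]].
have yr : (y < r) = false by rewrite ltNge (ltW ry).
move: rA; rewrite yr/= => /andP[xr pr].
have rx : (r < x) = false by rewrite ltNge (ltW xr).
by move: rB; rewrite rx/= => rq; rewrite (ltW xr) (ltW ry) pr rq.
Qed.

(* The gap between two consecutive spheres has length [u i.+1 - u i], so the
   gaps telescope. *)
Lemma clamp_chain (R : realType) (x y eps : R) (u : nat -> R) (L : nat) :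
  0 <= x -> x <= y -> 0 <= eps -> 0 <= u 0%N ->
  (forall i, (i < L)%N -> u i <= u i.+1) ->
  clamp x y (u L + L.+1%:R * eps) - x - u L
  <= \sum_(i < L.+1)
       (clamp x y (u i + i.+1%:R * eps) - clamp x y (u i + i%:R * eps)).
Proof.
move=> x0 xy e0 u0; elim: L => [_|L ih uS].
  rewrite big_ord_recl big_ord0 addr0 /= mul0r addr0.
  have := clamp_lip xy u0.
  rewrite [X in _ - X](_ : _ = x); first by lra.
  by rewrite /clamp max_l// min_r.
rewrite big_ord_recr/=; have {}ih := ih (fun i iL => uS i (ltnW iL)).
have uL := uS L (ltnSn L).
have pq : u L + L.+1%:R * eps <= u L.+1 + L.+1%:R * eps by rewrite lerD2r.
have := clamp_lip xy pq.
by move: ih; lra.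
Qed.
(* [order_statistic] with a rank in [nat], so that it can be summed by pieces. *)
Definition order_seq (R : realType) (n : nat) (z : 'I_n -> R) (i : nat) : R :=
  nth 0 (sort <=%R (codom z)) i.

Lemma size_order_seq (R : realType) (n : nat) (z : 'I_n -> R) :
  size (sort <=%R (codom z)) = n.
Proof. by rewrite size_sort size_codom card_ord. Qed.

Lemma order_seq_le (R : realType) (n : nat) (z : 'I_n -> R) (i j : nat) :
  (i <= j)%N -> (j < n)%N -> order_seq z i <= order_seq z j.
Proof.
move=> ij jn.
apply: (sorted_leq_nth le_trans lexx 0 (sort_le_sorted (codom z))) => //;
  by rewrite inE size_order_seq// (leq_ltn_trans ij).
Qed.

Lemma order_seq_ge0 (R : realType) (n : nat) (z : 'I_n -> R) (i : nat) :
  (forall k, 0 <= z k) -> (i < n)%N -> 0 <= order_seq z i.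
Proof.
move=> z0 ni; have : order_seq z i \in codom z.
  by rewrite -(mem_sort <=%R) mem_nth// size_order_seq.
by case/codomP => k ->.
Qed.

(** In the sorted list the values at most [a] form a prefix, whose length is their number. *)
Lemma order_seq_leE (R : realType) (n : nat) (z : 'I_n -> R) (i : nat) (a : R) :
  (i < n)%N ->
  (order_seq z i <= a) = (i < \sum_(k < n) (z k <= a)%R)%N.
Proof.
move=> ni; rewrite (_ : (\sum_(k < n) _)%N = count (<= a) (sort <=%R (codom z))).
  have ss := sort_le_sorted (codom z).
  have [ic|ci] := ltnP; first exact: nth_count_le.
  by apply/negbTE; rewrite -ltNge nth_count_gt// ci size_order_seq.
rewrite (permP (permEl (perm_sort _ _))) count_map -sum1_count.
by rewrite [RHS]big_mkcond [RHS]big_enum/=; apply: eq_bigr => k _; case: (_ <= a).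
Qed.

Lemma measurable_order_seq (disp : measure_display) (T : measurableType disp)
    (R : realType) (n : nat) (Z : 'I_n -> T -> R) (i : nat) :
  (i < n)%N -> (forall k, measurable_fun [set: T] (Z k)) ->
  measurable_fun [set: T] (fun w => order_seq (fun k => Z k w) i).
Proof.
move=> ni mZ mT; apply: (measurability _ (RGenOInfty.measurableE R)) => //.
move=> _ [_ [a ->] <-]; rewrite setTI.
(* The offset [1/2] separates [i] from [i + 1], turning a comparison of integers into a strict
   comparison of reals. *)
rewrite (_ : _ @^-1` _ =
    ~` [set w | i%:R + 1/2 < \sum_(k < n) (\1_[set x | x <= a] (Z k w)) :> R]).
  apply: measurableC; apply: measurable_set_gt; apply: measurable_sum => k.
  apply: measurableT_comp => //; apply: measurable_indic.
  by rewrite (_ : [set _ | _] = `]-oo, a]%classic).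
have cE w : (order_seq (fun k => Z k w) i <= a) =
    (i%:R + 1/2 < \sum_(k < n) (\1_[set x | x <= a] (Z k w)) :> R).
  have -> : \sum_(k < n) (\1_[set x | x <= a] (Z k w)) =
      (\sum_(k < n) (Z k w <= a)%R)%N%:R :> R.
    rewrite natr_sum; apply: eq_bigr => k _; rewrite indicE.
    by congr (_%:R); congr nat_of_bool; apply/idP/idP; rewrite inE.
  rewrite order_seq_leE//; set m := (\sum_(k < n) _)%N.
  have [im|mi] := ltnP.
    by move: im; rewrite -(ler_nat R) -natr1 => im; apply/esym; lra.
  by move: mi; rewrite -(ler_nat R) => mi; apply/esym/negbTE; rewrite -leNgt; lra.
apply/seteqP; split => w /=; rewrite in_itv/= andbT -cE.
  by rewrite ltNge => /negP.
by move/negP; rewrite -ltNge.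
Qed.

(** * Deterministic bounds on the density *)

(** The shift [c * t] is common to window and spheres and cancels. The spheres are disjoint because
    for [i < j] the values are ordered and [i.+1%:R * eps <= j%:R * eps], so their lengths add
    up. *)
Lemma density_clamp (R : realType) (eps c : R) (n : nat) (z : 'I_n -> R)
    (t x y : R) : 0 <= eps -> x <= y ->
  density eps c z t x y =
  ((\sum_(i < n) (clamp x y (order_seq z i + i.+1%:R * eps)
     - clamp x y (order_seq z i + i%:R * eps))) / (y - x))%:E.
Proof.
move=> e0 xy; pose p (k : 'I_n) := order_seq z k + k%:R * eps + c * t.
have sE k : sphere eps c z t k = `]p k, p k + eps[%classic.
  rewrite /sphere (_ : sphere_center _ _ _ _ _ = p k + eps / 2).
    by rewrite addrK -addrA -splitr.
  by rewrite /p /sphere_center /order_statistic /order_seq; ring.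
rewrite /density EFinM; congr (_ * _)%E.
rewrite setI_bigcupr.
rewrite (_ : \bigcup_(k in _) _ = \big[setU/set0]_(k < n)
    (`[x + c * t, y + c * t] `&` sphere eps c z t k)); last first.
  rewrite (_ : [set: 'I_n] = [set` (predT : {pred 'I_n})]) ?bigcup_pred//.
  by apply/seteqP; split.
rewrite measure_bigsetU_ord; last 2 first.
- by move=> k; rewrite sE; apply: measurableI; exact: measurable_itv.
- suff tI (i j : 'I_n) : (i < j)%N ->
      (`[x + c * t, y + c * t] `&` sphere eps c z t i) `&`
      (`[x + c * t, y + c * t] `&` sphere eps c z t j) = set0.
    apply/trivIsetP => i j _ _; rewrite neq_ltn => /orP[/tI//|/tI].
    by rewrite setIC.
  move=> ij; rewrite -subset0 => r [[_]]; rewrite sE/= in_itv/= => /andP[_ ri] [_].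
  rewrite sE/= in_itv/= => /andP[rj _].
  have := order_seq_le z (ltnW ij) (ltn_ord j).
  have : (i.+1%:R : R) * eps <= j%:R * eps by rewrite ler_wpM2r// ler_nat.
  by move: ri rj; rewrite /p -natr1; lra.
rewrite -sumEFin; apply: eq_bigr => k _; rewrite sE.
have xyc : x + c * t <= y + c * t by rewrite lerD2r.
have pk : p k <= p k + eps by rewrite lerDl.
rewrite [LHS](lebesgue_measure_clamp xyc pk).
rewrite (_ : p k + eps = order_seq z k + k.+1%:R * eps + c * t); last first.
  by rewrite /p -natr1; ring.
by rewrite /p !clampDr; congr _%:E; ring.
Qed.
Lemma clamp_step_ge0 (R : realType) (x y eps u : R) (i : nat) : 0 <= eps ->
  0 <= clamp x y (u + i.+1%:R * eps) - clamp x y (u + i%:R * eps).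
Proof.
move=> e0; rewrite subr_ge0; apply: clamp_le.
by rewrite lerD2l ler_wpM2r// ler_nat.
Qed.

(** The lowest [L] spheres reach beyond [y], and the gaps below and between them have total length
    [order_seq z L.-1 <= d]. *)
Lemma density_ge (R : realType) (eps c : R) (n : nat) (z : 'I_n -> R)
    (t x y d : R) : 0 <= eps -> 0 <= x -> x < y -> (forall k, 0 <= z k) ->
  y <= (\sum_(k < n) (z k <= d)%R)%N%:R * eps ->
  (((y - x - d) / (y - x))%:E <= density eps c z t x y)%E.
Proof.
move=> e0 x0 xy z0; set L := (\sum_(k < n) _)%N => yL.
have xy' := ltW xy.
have Ln : (L <= n)%N.
  rewrite -[leqRHS]card_ord -sum1_card; apply: leq_sum => k _; exact: leq_b1.
have L0 : (0 < L)%N.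
  by rewrite lt0n; apply/eqP => L0; move: yL; rewrite L0 mul0r; lra.
rewrite density_clamp// lee_fin ler_wpM2r ?invr_ge0 ?subr_ge0//.
rewrite -(big_mkord xpredT (fun i => clamp x y (order_seq z i + i.+1%:R * eps) -
  clamp x y (order_seq z i + i%:R * eps)))/=.
rewrite (big_cat_nat (leq0n L) Ln)//= big_mkord.
have tail0 : 0 <= \sum_(L <= i < n) (clamp x y (order_seq z i + i.+1%:R * eps) -
  clamp x y (order_seq z i + i%:R * eps)).
  by apply: sumr_ge0 => i _; exact: clamp_step_ge0.
have ud : order_seq z L.-1 <= d.
  by rewrite order_seq_leE ?prednK.
(* [clamp_chain] counts by the rank of the last sphere, which is one less than the number of
   spheres. *)
case: L => [//|L] in yL Ln L0 ud tail0 *.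
have u0 i : (i < n)%N -> 0 <= order_seq z i by exact: order_seq_ge0.
have uS i : (i < L)%N -> order_seq z i <= order_seq z i.+1.
  by move=> iL; apply: order_seq_le => //; rewrite (leq_trans _ Ln).
have := clamp_chain x0 xy' e0 (u0 _ (leq_trans L0 Ln)) uS.
have uL := u0 _ Ln.
have -> : clamp x y (order_seq z L + L.+1%:R * eps) = y.
  by rewrite /clamp min_l// le_max; apply/orP; right; lra.
by move: ud tail0 => /=; lra.
Qed.

(** Spheres with value at most [d] end before [d + n%:R * eps <= x]; each of the others contributes
    at most [eps]. *)
Lemma density_le (R : realType) (eps c : R) (n : nat) (z : 'I_n -> R)
    (t x y d : R) : 0 <= eps -> x < y -> d + n%:R * eps <= x ->
  (density eps c z t x y <=
   ((n%:R - (\sum_(k < n) (z k <= d)%R)%N%:R) * eps / (y - x))%:E)%E.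
Proof.
move=> e0 xy dx; set L := (\sum_(k < n) _)%N.
have xy' := ltW xy.
have Ln : (L <= n)%N.
  rewrite -[leqRHS]card_ord -sum1_card; apply: leq_sum => k _; exact: leq_b1.
rewrite density_clamp// lee_fin ler_wpM2r ?invr_ge0 ?subr_ge0//.
rewrite -(big_mkord xpredT (fun i => clamp x y (order_seq z i + i.+1%:R * eps) -
  clamp x y (order_seq z i + i%:R * eps)))/=.
rewrite (big_cat_nat (leq0n L) Ln)//= big_nat big1 ?add0r; last first.
  move=> i /= iL; have iE : order_seq z i <= d.
    by rewrite order_seq_leE// (leq_trans iL).
  have cE r : r <= x -> clamp x y r = x by move=> rx; rewrite /clamp max_l// min_r.
  have ein : i.+1%:R * eps <= n%:R * eps.
    by rewrite ler_wpM2r// ler_nat (leq_trans iL).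
  have ei : i%:R * eps <= i.+1%:R * eps by rewrite ler_wpM2r// ler_nat.
  by rewrite !cE ?subrr//; lra.
rewrite -natrB// mulr_natl -[leRHS]sumr_const_nat; apply: ler_sum => i _.
have pq : order_seq z i + i%:R * eps <= order_seq z i + i.+1%:R * eps.
  by rewrite lerD2l ler_wpM2r// ler_nat.
by rewrite (le_trans (clamp_lip xy' pq))// -natr1; lra.
Qed.

(** * Tail of the reflected process, and the number of large values *)

Lemma exponential_prob_tail (disp : measure_display) (T : measurableType disp)
    (R : realType) (P : probability T R) (X : {RV P >-> R}) (r y : R) :
  (forall A, measurable A -> P (X @^-1` A) = exponential_prob r A) -> 0 < y ->
  (P [set w | (y < X w)%R] <= (expR (- (r * y)))%:E)%E.
Proof.
move=> XE y0; have mI : measurable (X @^-1` `[0, y]).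
  by rewrite -[X in measurable X]setTI; exact: measurable_funP.
apply: (@le_trans _ _ (P (~` (X @^-1` `[0, y])))).
  apply: le_measure; rewrite ?inE; [exact: measurable_set_gt|exact: measurableC|].
  by move=> w /= yX; rewrite in_itv/= => /andP[_]; rewrite leNgt yX.
rewrite probability_setC// XE// exponential_prob_itv0c//.
by rewrite -!EFinB lee_fin mulNr; lra.
Qed.

(** If [Z t] exceeds [d], either [Z 0] or the supremum exceeds [d / 2]. Both tails have rate
    [2 * c], so each costs [expR (- (c * d))]. *)
Lemma reflected_tail (disp : measure_display) (T : measurableType disp)
    (R : realType) (P : probability T R) (B Z : R -> {RV P >-> R}) (c t d : R) :
  0 < c -> 0 <= t -> 0 < d -> brownian_motion B ->
  (forall A, measurable A -> P (Z 0 @^-1` A) = exponential_prob (2 * c) A) ->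
  {ae P, forall w, reflected_at_0 (fun t => Z 0 w + B t w - c * t)
                                  (fun t => Z t w)} ->
  (P [set w | (d < Z t w)%R] <= (2 * expR (- (c * d)))%:E)%E.
Proof.
move=> c0 t0 d0 bB Z0 refl; have d2 : 0 < d / 2 by lra.
have [F [mF PF FB]] := brownian_sup_tail bB c0 t0 d2.
have mZ0 : measurable [set w | d / 2 < Z 0 w] by exact: measurable_set_gt.
have PZ := exponential_prob_tail Z0 d2.
apply: (@le_trans _ _ (P ([set w | d / 2 < Z 0 w] `|` F))).
  apply: le_measure_ae; [exact: measurable_set_gt|exact: measurableU|].
  have [_ _ _ cB] := bB.
  apply: filterS2 cB refl => w cBw rw dZ.
  have [s [s0 st zle]] := reflected_le rw t0.
  have [?|Z0d] := ltP (d / 2) (Z 0 w); [by left|right].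
  by apply: (FB w s) => //; move: zle dZ => /=; lra.
rewrite (le_trans (measureU2 _ mZ0 mF))//.
rewrite (le_trans (leeD PZ PF))// -EFinD lee_fin.
rewrite (_ : 2 * c * (d / 2) = c * d); first by lra.
by field.
Qed.

(** Markov's inequality for the number of events that occur, whose expectation is at most
    [n%:R * q]. *)
Lemma count_tail (disp : measure_display) (T : measurableType disp)
    (R : realType) (P : probability T R) (n : nat) (A : 'I_n -> set T) (q eta : R) :
  (0 < n)%N -> 0 < eta -> (forall k, measurable (A k)) ->
  (forall k, P (A k) <= q%:E)%E ->
  (P [set w | (eta * n%:R < \sum_(k < n) \1_(A k) w)%R] <= (q / eta)%:E)%E.
Proof.
move=> n0 eta0 mA PA; set E := [set w | _].
have n0' : 0 < n%:R :> R by rewrite ltr0n.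
have en0 : 0 < eta * n%:R by rewrite mulr_gt0.
have mS : measurable_fun [set: T] (fun w => \sum_(k < n) \1_(A k) w : R).
  by apply: measurable_sum => k; exact: measurable_indic.
have mE : measurable E by exact: measurable_set_gt.
have qE : q / eta = (eta * n%:R)^-1 * (n%:R * q) by field; rewrite !gt_eqF.
rewrite qE EFinM lee_pdivlMl//.
apply: (@le_trans _ _ (\int[P]_w (\sum_(k < n) (\1_(A k) w)%:E))%E); last first.
  rewrite ge0_integral_sum//; last first.
    by move=> k; apply/measurable_EFinP; exact: measurable_indic.
  rewrite -[n in n%:R * q]card_ord mulr_natl -sumr_const -sumEFin.
  by apply: lee_sum => k _; rewrite integral_indic// setIT; exact: PA.
rewrite -[E]setIT -integral_indic// -ge0_integralZl//; last 2 first.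
- by apply/measurable_EFinP; exact: measurable_indic.
- by rewrite lee_fin ltW.
apply: ge0_le_integral => //.
- by move=> w _; rewrite -EFinM lee_fin mulr_ge0// ltW.
- by apply: emeasurable_funM => //; apply/measurable_EFinP; exact: measurable_indic.
- by under eq_fun do rewrite sumEFin; apply/measurable_EFinP.
- move=> w _; rewrite sumEFin -EFinM lee_fin indicE.
  have [|_] := boolP (w \in E); first by rewrite inE/= mulr1 => /ltW.
  by rewrite mulr0 sumr_ge0.
Qed.

(** Gives the measurability of the density events that [le_measure_ae] requires. *)
Lemma measurable_density (disp : measure_display) (T : measurableType disp)
    (R : realType) (eps c t x y : R) (n : nat) (Z : 'I_n -> T -> R) :
  0 <= eps -> x <= y -> (forall k, measurable_fun [set: T] (Z k)) ->
  exists2 f : T -> R, measurable_fun [set: T] f &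
    forall w, density eps c (fun k => Z k w) t x y = (f w)%:E.
Proof.
move=> e0 xy mZ.
pose u i w := order_seq (fun k => Z k w) i.
exists (fun w => (\sum_(i < n) (clamp x y (u i w + i.+1%:R * eps)
  - clamp x y (u i w + i%:R * eps))) / (y - x)); last first.
  by move=> w; rewrite density_clamp.
apply: measurable_funM => //; apply: measurable_sum => i.
have mu a : measurable_fun [set: T] (fun w => clamp x y (u i w + a)).
  apply: measurable_minr => //; apply: measurable_maxr => //.
  by apply: measurable_funD => //; exact: measurable_order_seq.
exact: measurable_funB.
Qed.

(** * Choice of the constants and conclusion *)

Theorem theorem2p1 (R : realType) (b p1 d1 d2 x1 x2 x3 x4 : R) :
  0 < b -> p1 < 1 -> d1 < 1 -> 0 < d2 ->
  0 <= x1 -> x1 < x2 -> x2 < b -> b < x3 -> x3 < x4 ->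
  exists (c0 : R) (n0 : nat),
    forall (c : R) (n : nat), 0 < c -> (1 <= n)%N -> c0 <= c -> (n0 <= n)%N ->
    forall (disp : measure_display) (T : measurableType disp)
      (P : probability T R) (B Z : 'I_n -> R -> {RV P >-> R}),
      reflected_drifted_bms c B Z -> pseudo_stationary c Z ->
      forall t : R, 0 <= t ->
        (p1%:E <= P [set w | d1%:E <=
           density (b / n%:R) c (fun k => Z k t w) t x1 x2])%E /\
        (p1%:E <= P [set w |
           density (b / n%:R) c (fun k => Z k t w) t x3 x4 <= d2%:E])%E.
Proof.
move=> b0 p11 d11 d20 x10 x12 x2b bx3 x34.
(* The first bound makes gaps of total length [delta] affordable in [[x1, x2]]; the second gives
   [b + delta <= x3]. *)
pose delta := Num.min ((1 - d1) * (x2 - x1)) (x3 - b).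
(* Losing [eta * n] spheres loses length [eta * b]: what remains still reaches [x2], and what is
   lost fills at most [d2 * (x4 - x3)]. *)
pose eta := Num.min ((b - x2) / b) (d2 * (x4 - x3) / b).
have delta0 : 0 < delta by rewrite lt_min mulr_gt0 ?subr_gt0.
have eta0 : 0 < eta by rewrite lt_min !divr_gt0// ?mulr_gt0 ?subr_gt0.
have [deltal deltau] : delta <= (1 - d1) * (x2 - x1) /\ delta <= x3 - b.
  by split; rewrite ge_min lexx ?orbT.
have [etal etau] : eta * b <= b - x2 /\ eta * b <= d2 * (x4 - x3).
  by split; rewrite -ler_pdivlMr// ge_min lexx ?orbT.
(* Chosen so that Markov's bound [2 * q / eta] equals [1 - p1]. *)
pose q := eta * (1 - p1) / 2.
have q0 : 0 < q by rewrite divr_gt0// mulr_gt0// subr_gt0.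
(* For [c] beyond this threshold, [expR (- (c * delta)) <= q]. *)
exists (- ln q / delta), 1%N => c n c0 n0 cc _ disp T P B Z.
move=> [BB _ refl] [_ Z0] t t0.
have n0' : 0 < n%:R :> R by rewrite ltr0n.
have eps0 : 0 <= b / n%:R by rewrite ltW// divr_gt0.
pose A k := [set w | delta < Z k t w].
have mA k : measurable (A k) by exact: measurable_set_gt.
have PA k : (P (A k) <= (2 * q)%:E)%E.
  apply: le_trans (reflected_tail c0 t0 delta0 (BB k) (Z0 k) (refl k)) _.
  rewrite lee_fin ler_pM2l// -[leRHS]lnK ?posrE// ler_expR.
  by rewrite lerNl -ler_pdivrMr.
have := count_tail n0 eta0 mA PA.
set E := [set w | _] => PE.
have mE : measurable E.
  apply: measurable_set_gt; apply: measurable_sum => k; exact: measurable_indic.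
have {}PE : (p1%:E <= P (~` E))%E.
  rewrite probability_setC// -[P E]fineK ?fin_num_measure// -EFinB lee_fin.
  have : fine (P E) <= 2 * q / eta by rewrite -lee_fin fineK ?fin_num_measure.
  rewrite (_ : 2 * q / eta = 1 - p1); first lra.
  by rewrite /q; field; rewrite gt_eqF.
have Zpos : {ae P, forall w, forall k, 0 <= Z k t w}.
  apply: filter_forall => k; apply: filterS (refl k) => w [_ [l [_ z0 _ _]]].
  exact: z0.
(* Off [E], at most [eta * n%:R] of the values exceed [delta]; the complementary count is what the
   density bounds take. *)
have countE w : ~ E w ->
    n%:R - (\sum_(k < n) (Z k t w <= delta)%R)%N%:R <= eta * n%:R.
  move=> /negP; rewrite -leNgt; apply: le_trans.
  rewrite lerBlDr natr_sum -big_split/=.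
  rewrite -[leLHS]mulr1 -[n in n%:R * _]card_ord mulr_natl -sumr_const.
  apply: ler_sum => k _; rewrite indicE.
  have [Zd|Zd] := leP (Z k t w) delta; first by rewrite lerDr.
  by rewrite mem_set// lerDl.
have mZ k : measurable_fun [set: T] (Z k t) by exact: measurable_funP.
split.
  have [f mf fE] := measurable_density c t eps0 (ltW x12) mZ.
  apply: (le_trans PE); apply: le_measure_ae; first exact: measurableC.
    under eq_set do rewrite fE lee_fin -lerN2.
    by apply: measurable_set_le; exact: measurableT_comp.
  apply: filterS Zpos => w Zw Ew /=.
  apply: le_trans (density_ge (d := delta) _ _ eps0 x10 x12 Zw _).
    rewrite lee_fin ler_pdivlMr ?subr_gt0//; lra.
  have cw := countE w Ew; rewrite mulrA ler_pdivlMr//.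
  have bcw := ler_wpM2r (ltW b0) cw.
  have nb := ler_wpM2r (ltW n0') etal.
  by move: bcw nb; lra.
have [f mf fE] := measurable_density c t eps0 (ltW x34) mZ.
apply: (le_trans PE); apply: le_measure_ae; first exact: measurableC.
  under eq_set do rewrite fE lee_fin.
  exact: measurable_set_le.
apply: aeW => w Ew /=.
apply: le_trans (density_le (d := delta) _ _ _ eps0 x34 _) _.
  by rewrite mulrC divfK ?gt_eqF//; lra.
rewrite lee_fin ler_pdivrMr ?subr_gt0// mulrA ler_pdivrMr//.
have cw := ler_wpM2r (ltW b0) (countE w Ew).
have nb := ler_wpM2r (ltW n0') etau.
by move: cw nb; lra.
Qed.
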